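(* Let $n\in\mathbb{N}$, $n\ge2$, let $X_1,\dots,X_n$ be i.i.d. with distribution $\mathbb{P}\in\mathcal{P}(\mathcal{X})$, let $\delta\in(0,1)$, and let $k$ be a characteristic reproducing kernel. Then with probability at least $1-\delta$, it holds that $$\left\|\widehat{\mu}_{\mathbb{P}}-\mu_{\mathbb{P}}\right\|_{\mathcal{H}_k}\le \sqrt{2\left(\widehat{v}(X_1,\dots,X_n)+\Delta\operatorname{diag}k\right)\frac{\log(4/\delta)}{n}}+\left(\frac{16}{3}\sqrt{\Delta k}+2\sqrt2\sqrt{\Delta\operatorname{diag}k}\right)\frac{\log(4/\delta)}{n},$$ where $$\widehat{v}(X_1,\dots,X_n)=\frac{1}{n-1}\sum_{t=1}^n\left(k(X_t,X_t)-\frac1n\sum_{s=1}^n k(X_t,X_s)\right).$$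
   Context: $\mathcal{X}$ is a separable topological space and $\mathcal{P}(\mathcal{X})$ is the set of Borel probability measures on $\mathcal{X}$. The kernel $k\colon\mathcal{X}\times\mathcal{X}\to\mathbb{R}$ is a continuous, bounded ($\sup_x k(x,x)<\infty$) positive definite kernel with RKHS $\mathcal{H}_k$; characteristic means that $\mathbb{P}\mapsto\mu_{\mathbb{P}}$ is injective on $\mathcal{P}(\mathcal{X})$. The kernel mean embedding is the Bochner integral $\mu_{\mathbb{P}}=\mathbb{E}_{X\sim\mathbb{P}}[k(X,\cdot)]\in\mathcal{H}_k$ and $\widehat{\mu}_{\mathbb{P}}=\frac1n\sum_{t=1}^n k(X_t,\cdot)$. For a bounded function $f$ on a set, $\Delta f=\sup f-\inf f$. Thus $\Delta k=\sup_{(x,x')\in\mathcal{X}^2}k(x,x')-\inf_{(x,x')\in\mathcal{X}^2}k(x,x')$, and with $\operatorname{diag}k(x)=k(x,x)$, $\Delta\operatorname{diag}k=\sup_{x\in\mathcal{X}}k(x,x)-\inf_{x\in\mathcal{X}}k(x,x)$. *)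

(* Defs.v *)
From HB Require Import structures.
From mathcomp Require Import all_boot all_order all_algebra.
From mathcomp Require Import all_classical all_reals all_analysis.

Set Implicit Arguments.
Unset Strict Implicit.
Unset Printing Implicit Defensive.
Import Order.TTheory GRing.Theory Num.Theory.
Import numFieldNormedType.Exports.

Local Open Scope classical_set_scope.
Local Open Scope ring_scope.

Definition separable (T : topologicalType) : Prop :=
  exists2 D : set T, countable D & dense D.

(* The library's measurable types are pointed, hence [ptopologicalType]; an
   empty space carries no probability measure. *)
Notation borel X := (g_sigma_algebraType (@open X)).

Definition positive_definite (R : realType) (X : Type) (k : X -> X -> R) : Prop :=
  (forall x y, k x y = k y x) /\
  (forall (m : nat) (c : 'I_m -> R) (x : 'I_m -> X),
     0 <= \sum_(i < m) \sum_(j < m) c i * c j * k (x i) (x j)).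

(* A Hilbert space of functions on [X] with reproducing kernel [k]. Its elements
   are an abstract type [rkhs_space] identified with functions on [X] through
   the injective linear map [rkhs_fun]; [rkhs_at x] is the function k(x, .).
   By the Moore-Aronszajn theorem such a space exists for every positive definite
   [k] and is unique up to an isometry that preserves [rkhs_fun]. *)
Record rkhs (R : realType) (X : Type) (k : X -> X -> R) := Rkhs {
  rkhs_space :> completeNormedModType R ;
  rkhs_dot : {dot rkhs_space for idfun} ;
  rkhs_normE : forall f : rkhs_space, `|f| ^+ 2 = rkhs_dot f f ;
  rkhs_fun : rkhs_space -> X -> R ;
  rkhs_fun_linear : forall (a : R) (f g : rkhs_space) (x : X),
    rkhs_fun (a *: f + g) x = a * rkhs_fun f x + rkhs_fun g x ;
  rkhs_fun_inj : injective rkhs_fun ;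
  rkhs_at : X -> rkhs_space ;
  rkhs_atE : forall x y : X, rkhs_fun (rkhs_at x) y = k x y ;
  rkhs_reproducing : forall (f : rkhs_space) (x : X),
    rkhs_fun f x = rkhs_dot f (rkhs_at x)
}.

Section bochner.
Context (d : measure_display) (T : measurableType d) (R : realType).
Context (E : normedModType R) (mu : probability T R).

Definition bochner_simple (s : {fimfun T >-> E}) : Prop :=
  forall y : E, measurable (s @^-1` [set y]).

Definition bochner_sintegral (s : {fimfun T >-> E}) : E :=
  \sum_(y \in [set: E]) fine (mu (s @^-1` [set y])) *: y.

(* [f] is strongly measurable and approximated in L^1 by simple functions whose
   integrals tend to [v]. *)
Definition has_bochner_integral (f : T -> E) (v : E) : Prop :=
  exists s : nat -> {fimfun T >-> E},
    [/\ forall n, bochner_simple (s n),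
        {ae mu, forall x, s n x @[n --> \oo] --> f x},
        (\int[mu]_x (`|f x - s n x|)%:E)%E @[n --> \oo] --> 0%E
      & bochner_sintegral (s n) @[n --> \oo] --> v].

(* Total: 0 when [f] is not Bochner integrable. *)
Definition bochner_integral (f : T -> E) : E :=
  xget 0 [set v | has_bochner_integral f v].

End bochner.

Section kernel_mean_embedding.
Context (R : realType) (X : ptopologicalType) (k : X -> X -> R) (H : rkhs k).

Definition mean_embedding (P : probability (borel X) R) : H :=
  bochner_integral P (rkhs_at H : borel X -> H).

Definition empirical_embedding (n : nat) (x : 'I_n -> X) : H :=
  n%:R^-1 *: \sum_(t < n) rkhs_at H (x t).

(* Two measures are the same when they agree on measurable sets: the values of
   a [probability] outside of them are arbitrary. *)
Definition characteristic : Prop :=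
  forall P Q : probability (borel X) R,
    mean_embedding P = mean_embedding Q ->
    forall A : set (borel X), measurable A -> P A = Q A.

End kernel_mean_embedding.

Section random_variables.
Context (d d' : measure_display) (Omega : measurableType d).
Context (T : measurableType d') (R : realType) (Pr : probability Omega R).

Definition mutually_independent (I : finType) (Z : I -> {RV Pr >-> T}) : Prop :=
  forall (J : {set I}) (A : I -> set T),
    (forall i, i \in J -> measurable (A i)) ->
    Pr (\bigcap_(i in [set` J]) (Z i @^-1` A i)) =
    (\prod_(i in J) Pr (Z i @^-1` A i))%E.

Definition iid (I : finType) (P : probability T R) (Z : I -> {RV Pr >-> T}) : Prop :=
  (forall (i : I) (A : set T), measurable A -> distribution Pr (Z i) A = P A) /\
  mutually_independent Z.

Definition with_probability_at_least (p : R) (E : set Omega) : Prop :=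
  measurable E /\ (p%:E <= Pr E)%E.

End random_variables.

Definition oscillation (R : realType) (T : Type) (f : T -> R) : R :=
  sup (range f) - inf (range f).

Definition vhat (R : realType) (X : Type) (k : X -> X -> R) (n : nat)
    (x : 'I_n -> X) : R :=
  (n%:R - 1)^-1 *
  \sum_(t < n) (k (x t) (x t) - n%:R^-1 * \sum_(s < n) k (x t) (x s)).

(* Main.v *)
Require Import Defs.
From HB Require Import structures.
From mathcomp Require Import all_boot all_order all_algebra.
From mathcomp Require Import all_classical all_reals all_analysis.
From mathcomp Require Import measurable_realfun ring lra.

Set Implicit Arguments.
Unset Strict Implicit.
Unset Printing Implicit Defensive.
Import Order.TTheory GRing.Theory Num.Theory.
Import numFieldNormedType.Exports.

Local Open Scope classical_set_scope.
Local Open Scope ring_scope.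

(** Write Phi x = k(x, .) for the feature map, xi_t = Phi(X_t) - mu, e for the
    norm of the mean of the xi_t, v for E|xi|^2, K for the oscillation of k
    and L = ln(4/delta)/n, so that exp(-nL) = delta/4. Since
    |Phi x - Phi y|^2 <= 2K, every |xi_t| is at most sqrt(2K), and v <= K.

    Two deviation events carry the probability. The norm satisfies the
    Hilbert-space Bernstein inequality
      e <= sqrt(2vL) + sqrt(2K)/3 * L
    outside an event of probability 2 exp(-nL) ([iid_norm_tail]). This is
    Pinelis' argument: cosh|x + y| is at most cosh|x| (exp|y| - |y|) plus a term
    linear in y ([coshR_normD]), and the linear term has mean zero, so
    E cosh|sum xi_t| is at most the n-th power of E(exp|xi| - |xi|). The mean of
    the nonnegative variables |xi_t|^2 is at least v - sqrt(4KvL) outside an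
    event of probability exp(-nL) ([iid_lower_tail]).

    To replace v by the empirical variance, note that the latter equals
    n/(n-1) (mean |xi_t|^2 - e^2). If v <= 9KL, the term sqrt(2vL) is absorbed by
    a multiple of sqrt(K) L. If v > 9KL, both events together give that the
    empirical variance is at least (sqrt v - 3 sqrt(KL))^2, which is what the
    claim needs ([empirical_sd_bound]). The total failure probability is
    3 exp(-nL) < delta.

    All of this is proved for a law with finitely many atoms, where
    independence is a finite product of weights and expectations are finite sums
    ([finite_empirical_bernstein]). The general law is reached by quantization:
    Phi is continuous and X has a countable dense set, so the map sending x
    to the image of the nearest among the first m + 1 points of a dense sequence is a
    simple function which converges pointwise to Phi. Its integrals converge to
    the Bochner integral of Phi ([quantize_mean_cvg]), the quantized sample is an
    i.i.d. sample of a finite law ([prob_sample_cells]), and a bound on the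
    probability of a strict inequality survives pointwise limits
    ([prob_lt_limit]). Quantization also settles measurability: on a product of
    spaces with large topologies a continuous k need not be measurable for the
    product sigma-algebra a priori, but here it is a limit of functions of
    finitely many cells. *)

(** * Hyperbolic and exponential inequalities *)

Section scalar.
Context (R : realType).
Implicit Types a b r t u v x y : R.

Definition coshR x : R := (expR x + expR (- x)) / 2.
Definition sinhR x : R := (expR x - expR (- x)) / 2.

Lemma expR_coshD_sinh x : expR x = coshR x + sinhR x.
Proof. by rewrite /coshR /sinhR; field. Qed.

Lemma coshRD x y : coshR (x + y) = coshR x * coshR y + sinhR x * sinhR y.
Proof. by rewrite /coshR /sinhR opprD !expRD; field. Qed.

Lemma coshRB x y : coshR (x - y) = coshR x * coshR y - sinhR x * sinhR y.
Proof. by rewrite /coshR /sinhR opprB addrC !expRD; field. Qed.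

Lemma coshR_gt0 x : 0 < coshR x.
Proof. by rewrite /coshR divr_gt0 ?addr_gt0 ?expR_gt0. Qed.

Lemma sinhR_le_coshR x : sinhR x <= coshR x.
Proof. by rewrite /sinhR /coshR; have := expR_gt0 (- x); lra. Qed.

Lemma expR_le_2coshR x : expR x <= 2 * coshR x.
Proof. by rewrite /coshR; have := expR_gt0 (- x); lra. Qed.

Lemma even_odd_powers x n :
  x ^+ n + (- x) ^+ n = if odd n then 0 else 2 * (x ^+ 2) ^+ n./2.
Proof.
rewrite exprNn -signr_odd -exprM mul2n -{1 3}(odd_double_half n).
by case: (odd n) => /=; rewrite ?expr1 ?expr0 ?add0n; ring.
Qed.

Lemma exprn_convex2 t u v n : 0 <= t <= 1 -> 0 <= u -> 0 <= v ->
  (t * u + (1 - t) * v) ^+ n <= t * u ^+ n + (1 - t) * v ^+ n.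
Proof.
move=> /andP[t0 t1] u0 v0; elim: n => [|n IH]; first by rewrite !expr0; lra.
set w := t * u + (1 - t) * v in IH *.
have w0 : 0 <= w by rewrite /w addr_ge0 ?mulr_ge0 ?subr_ge0.
rewrite exprS; apply: le_trans (ler_wpM2l w0 IH) _.
rewrite -subr_ge0 !exprS.
rewrite [leRHS](_ : _ = (t * (1 - t)) * ((u - v) * (u ^+ n - v ^+ n))); last first.
  by rewrite /w; ring.
apply: mulr_ge0; first by rewrite mulr_ge0 ?subr_ge0.
have [uv|/ltW uv] := leP u v.
  by rewrite -mulrNN !opprB mulr_ge0// subr_ge0// lerXn2r.
by rewrite mulr_ge0// subr_ge0// lerXn2r.
Qed.

(** The function z |-> cosh(sqrt z) is a power series in z with nonnegative
    coefficients, hence convex on the nonnegative half-line. The inequality is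
    checked on each pair of exponential-series terms for r and -r: odd terms
    cancel and even terms are convex powers of r^2. *)
Lemma coshR_sqrt_convex t u v r : 0 <= t <= 1 ->
  r ^+ 2 = t * u ^+ 2 + (1 - t) * v ^+ 2 ->
  coshR r <= t * coshR u + (1 - t) * coshR v.
Proof.
move=> t01 rE.
suff: expR r + expR (- r) <=
    t * (expR u + expR (- u)) + (1 - t) * (expR v + expR (- v)).
  by rewrite /coshR; lra.
have c x : series (exp_coeff x) n @[n --> \oo] --> expR x.
  exact: is_cvg_series_exp_coeff.
have ce x : (fun n => series (exp_coeff x) n + series (exp_coeff (- x)) n) @ \oo
    --> expR x + expR (- x) by apply: cvgD; exact: c.
pose c2 x n := series (exp_coeff x) n + series (exp_coeff (- x)) n.
have cr : (fun n => t * c2 u n + (1 - t) * c2 v n) @ \oo -->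
    t * (expR u + expR (- u)) + (1 - t) * (expR v + expR (- v)).
  by apply: cvgD; apply: cvgM; [exact: cvg_cst|exact: ce|exact: cvg_cst|exact: ce].
apply: (ler_cvg_to (ce r) cr); near=> n.
rewrite /c2 {c2 cr ce c}.
rewrite /= /series /exp_coeff /= -!big_split /= !mulr_sumr -big_split /=.
apply: ler_sum => i _; rewrite -!mulrDl !even_odd_powers.
case: ifP => _; first by rewrite !(mul0r, mulr0) addr0.
rewrite rE !mulrA -mulrDl ler_wpM2r ?invr_ge0 ?ler0n//.
have := exprn_convex2 i./2 t01 (sqr_ge0 u) (sqr_ge0 v).
rewrite -!mulrA ![_ * (2 * _)]mulrCA -mulrDr.
by rewrite ler_pM2l.
Unshelve. all: by end_near. Qed.

End scalar.
Section scalar_bounds.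
Context (R : realType).
Implicit Types x y u : R.

Lemma ge_value0_of_derive_ge0 (f g : R -> R) :
  (forall x, is_derive x (1 : R) f (g x)) -> (forall x, 0 <= x -> 0 <= g x) ->
  forall x, 0 <= x -> f 0 <= f x.
Proof.
move=> fg g0 x x0; apply: (@ger0_derive1_ndecry R f 0) => //.
- move=> y; rewrite in_itv/= andbT => y0; rewrite derive1E.
  by case: (fg y) => _ ->; rewrite g0 ?ltW.
- apply/continuous_subspaceT => y; apply/differentiable_continuous/derivable1_diffP.
  by case: (fg y).
Qed.

Lemma ge_sinhR x : 0 <= x -> x <= sinhR x.
Proof.
move=> x0; suff: expR 0 - expR (- 0) - 2 * 0 <= expR x - expR (- x) - 2 * x.
  by rewrite /sinhR oppr0; lra.
apply: (@ge_value0_of_derive_ge0 (fun y => expR y - expR (- y) - 2 * y)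
    (fun y => expR y + expR (- y) - 2)) x0 => y.
  apply: is_derive_eq. rewrite /GRing.scale /=; ring.
move=> y0; rewrite expRN.
have e0 := expR_gt0 y.
have -> : expR y + (expR y)^-1 - 2 = (expR y - 1) ^+ 2 / expR y.
  by field; exact: lt0r_neq0.
by rewrite divr_ge0 ?sqr_ge0 // ltW.
Qed.

Lemma expRN_le_quadratic x : 0 <= x -> expR (- x) <= 1 - x + x ^+ 2 / 2.
Proof.
move=> x0; suff: 1 - 0 + 0 ^+ 2 / 2 - expR (- 0) <= 1 - x + x ^+ 2 / 2 - expR (- x).
  by rewrite oppr0 expR0; lra.
apply: (@ge_value0_of_derive_ge0 (fun y => 1 - y + y ^+ 2 / 2 - expR (- y))
    (fun y => y - 1 + expR (- y))) x0 => y.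
  by apply: is_derive_eq; rewrite /GRing.scale /=; field.
by move=> _; have := expR_ge1Dx (- y); lra.
Qed.

(** Product form of exp x - x - 1 <= (x^2/2) / (1 - x/3), which makes sense for
    all x >= 0. Three times the derivative of the difference is
    x + 2 + exp x (x - 2), and the derivative of that is nonnegative because
    exp(-x) >= 1 - x. *)
Lemma expR_bernstein x : 0 <= x -> (1 - x / 3) * (expR x - x - 1) <= x ^+ 2 / 2.
Proof.
have h1 y : 0 <= y -> 0 <= y + 2 + expR y * (y - 2).
  move=> y0; suff: 0 + 2 + expR 0 * (0 - 2) <= y + 2 + expR y * (y - 2).
    by rewrite expR0; lra.
  apply: (@ge_value0_of_derive_ge0 (fun z => z + 2 + expR z * (z - 2))
    (fun z => 1 + expR z * (z - 1))) y0 => z.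
    by apply: is_derive_eq; rewrite /GRing.scale /=; ring.
   move=> _; have := expR_ge1Dx (- z); rewrite expRN.
  by rewrite -(ler_pM2l (expR_gt0 z)) divff ?lt0r_neq0 ?expR_gt0//; lra.
move=> x0; suff: 0 ^+ 2 / 2 - (1 - 0 / 3) * (expR 0 - 0 - 1) <=
    x ^+ 2 / 2 - (1 - x / 3) * (expR x - x - 1).
  by rewrite expR0; lra.
apply: (@ge_value0_of_derive_ge0 (fun z => z ^+ 2 / 2 - (1 - z / 3) * (expR z - z - 1))
    (fun z => (z + 2 + expR z * (z - 2)) / 3)) x0 => z.
  by apply: is_derive_eq; rewrite /GRing.scale /=; field.
by move=> z0; rewrite divr_ge0 ?h1.
Qed.

End scalar_bounds.
(** * Inner products and the growth of cosh of a norm *)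

Section inner_product.
Context (R : realType) (V : normedModType R) (dot : {dot V for idfun}).
Implicit Types (f g x y : V) (a : R).

Lemma dotC f g : dot f g = dot g f.
Proof. by rewrite (@hermC _ _ [the {rmorphism R -> R} of idfun])/= expr0 mul1r. Qed.

Lemma dotDr f g h : dot f (g + h) = dot f g + dot f h.
Proof. exact: (linearD (dot f)). Qed.

Lemma dotNr f g : dot f (- g) = - dot f g.
Proof. exact: (linearN (dot f)). Qed.

Lemma dotBr f g h : dot f (g - h) = dot f g - dot f h.
Proof. exact: (linearB (dot f)). Qed.

Lemma dotZr f a g : dot f (a *: g) = a * dot f g.
Proof. by rewrite linearZr_LR. Qed.

Lemma dot0r f : dot f 0 = 0.
Proof. exact: (linear0 (dot f)). Qed.

Lemma dot_sumr f (I : Type) (s : seq I) (P : pred I) (F : I -> V) :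
  dot f (\sum_(i <- s | P i) F i) = \sum_(i <- s | P i) dot f (F i).
Proof. exact: (linear_sum (dot f)). Qed.

Lemma dotDl f g h : dot (f + g) h = dot f h + dot g h.
Proof. by rewrite !(dotC _ h) dotDr. Qed.

Lemma dotBl f g h : dot (f - g) h = dot f h - dot g h.
Proof. by rewrite !(dotC _ h) dotBr. Qed.

Lemma dotZl a f g : dot (a *: f) g = a * dot f g.
Proof. by rewrite !(dotC _ g) dotZr. Qed.

Lemma dot0l f : dot 0 f = 0.
Proof. by rewrite dotC dot0r. Qed.

Lemma dot_suml f (I : Type) (s : seq I) (P : pred I) (F : I -> V) :
  dot (\sum_(i <- s | P i) F i) f = \sum_(i <- s | P i) dot (F i) f.
Proof. by rewrite dotC dot_sumr; apply: eq_bigr => i _; rewrite dotC. Qed.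

Hypothesis normE : forall f : V, `|f| ^+ 2 = dot f f.

Lemma sqr_normD f g : `|f + g| ^+ 2 = `|f| ^+ 2 + `|g| ^+ 2 + 2 * dot f g.
Proof. by rewrite !normE dotDl !dotDr (dotC g f); ring. Qed.

Lemma sqr_normB f g : `|f - g| ^+ 2 = `|f| ^+ 2 + `|g| ^+ 2 - 2 * dot f g.
Proof. by rewrite !normE dotBl !dotBr (dotC g f); ring. Qed.

Lemma dot_le_norm f g : dot f g <= `|f| * `|g|.
Proof.
have h : `|f + g| ^+ 2 <= (`|f| + `|g|) ^+ 2 by rewrite lerXn2r ?nnegrE ?addr_ge0 ?ler_normD.
by move: h; rewrite sqr_normD sqrrD; lra.
Qed.

Lemma norm_dot_le f g : `|dot f g| <= `|f| * `|g|.
Proof.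
rewrite ler_norml dot_le_norm andbT lerNl -dotNr -(normrN g).
exact: dot_le_norm.
Qed.

Lemma cvg_dot (T : Type) (F : set_system T) (FF : Filter F) (u v : T -> V) (a b : V) :
  u @ F --> a -> v @ F --> b -> dot (u x) (v x) @[x --> F] --> dot a b.
Proof.
move=> ua vb; have polar f g : dot f g = 2^-1 * (`|f + g| ^+ 2 - `|f| ^+ 2 - `|g| ^+ 2).
  by rewrite sqr_normD; field.
rewrite polar; under eq_fun do rewrite polar.
have sq (w : T -> V) c : w @ F --> c -> `|w x| ^+ 2 @[x --> F] --> `|c| ^+ 2.
  by move=> wc; apply: cvgM; apply: cvg_norm.
by apply: cvgM; [exact: cvg_cst|apply: cvgB; [apply: cvgB|]; apply: sq => //; apply: cvgD].
Qed.

(** With a = |x|, b = |y|, the number |x + y|^2 is the convex combination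
    t (a + b)^2 + (1 - t) (a - b)^2 where <x, y> = (2t - 1) ab. Convexity of
    cosh o sqrt bounds cosh|x + y| by the same combination of cosh(a + b) and
    cosh(a - b), and the addition formulas split off the term linear in <x, y>;
    the rest is bounded through b <= sinh b. *)
Lemma coshR_norm_addN x y : y != 0 -> x != 0 ->
  coshR `|x + y| <= coshR `|x| * (expR `|y| - `|y|) + sinhR `|x| / `|x| * dot x y.
Proof.
move=> y0 x0; set a := `|x|; set b := `|y|; set c := dot x y.
have a0 : 0 < a by rewrite normr_gt0.
have b0 : 0 < b by rewrite normr_gt0.
have ab0 : 0 < a * b by rewrite mulr_gt0.
have := norm_dot_le x y; rewrite -/a -/b -/c ler_norml => /andP[c1 c2].
pose t := (1 + c / (a * b)) / 2.
have cE : c = (2 * t - 1) * (a * b) by rewrite /t; field; apply/andP; split; apply: lt0r_neq0.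
have t01 : 0 <= t <= 1.
  have t1 : 0 <= (1 - t) * (2 * (a * b)) by move: c2; rewrite cE; lra.
  have t0 : 0 <= t * (2 * (a * b)) by move: c1; rewrite cE; lra.
  have ab2 : 0 < 2 * (a * b) by rewrite mulr_gt0.
  by rewrite -(pmulr_lge0 _ ab2) t0 -subr_ge0 -(pmulr_lge0 _ ab2).
have h : `|x + y| ^+ 2 = t * (a + b) ^+ 2 + (1 - t) * (a - b) ^+ 2.
  by rewrite sqr_normD -/a -/b -/c cE; ring.
apply: le_trans (coshR_sqrt_convex t01 h) _.
rewrite coshRD coshRB.
have -> : sinhR a / a * c = (2 * t - 1) * b * sinhR a.
  by rewrite cE; field; exact: lt0r_neq0.
rewrite (expR_coshD_sinh b).
have d0 : 0 <= sinhR b - b by rewrite subr_ge0 ge_sinhR ?ltW.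
have e1 : sinhR a * (sinhR b - b) <= coshR a * (sinhR b - b).
  by rewrite ler_wpM2r ?sinhR_le_coshR.
have e2 : - sinhR a * (sinhR b - b) <= coshR a * (sinhR b - b).
  rewrite ler_wpM2r//; apply: le_trans (ltW (coshR_gt0 a)).
  by rewrite oppr_le0; apply: le_trans (ge_sinhR (ltW a0)); exact: ltW.
case/andP: t01 => t0 t1.
rewrite -subr_ge0.
rewrite [X in 0 <= X](_ : _ = t * (coshR a * (sinhR b - b) - sinhR a * (sinhR b - b)) +
  (1 - t) * (coshR a * (sinhR b - b) - - sinhR a * (sinhR b - b))); last by ring.
by rewrite addr_ge0// mulr_ge0 ?subr_ge0.
Qed.

(** One step of Pinelis' argument. The last term is linear in y and vanishes on
    average when y is centred. For x = 0 the quotient is 0 by convention, in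
    agreement with dot 0 y = 0. *)
Lemma coshR_normD x y :
  coshR `|x + y| <= coshR `|x| * (expR `|y| - `|y|) + sinhR `|x| / `|x| * dot x y.
Proof.
have [->|y0] := eqVneq y 0.
  by rewrite addr0 normr0 expR0 dot0r subr0 mulr1 mulr0 addr0.
have [->|x0] := eqVneq x 0; last exact: coshR_norm_addN.
rewrite add0r normr0 dot0l mulr0 addr0 {2}/coshR oppr0 expR0.
have := ge_sinhR (normr_ge0 y); rewrite (expR_coshD_sinh `|y|); lra.
Qed.

End inner_product.
(** * Samples from a law with finitely many atoms *)

Section product_law.
Context (R : realType) (I : finType) (p : I -> R).
Hypothesis p_ge0 : forall i, 0 <= p i.
Hypothesis p_sum1 : \sum_i p i = 1.

Definition iid_expect n (F : {ffun 'I_n -> I} -> R) : R :=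
  \sum_(a : {ffun 'I_n -> I}) (\prod_t p (a t)) * F a.

Definition iid_prob n (Q : {ffun 'I_n -> I} -> bool) : R :=
  iid_expect (fun a => (Q a)%:R).

Lemma iid_expect_prod n (g : I -> R) :
  @iid_expect n (fun a => \prod_t g (a t)) = (\sum_i p i * g i) ^+ n.
Proof.
rewrite /iid_expect; under eq_bigr do rewrite -big_split /=.
rewrite -(bigA_distr_bigA (fun (_ : 'I_n) i => p i * g i)).
by rewrite prodr_const card_ord.
Qed.

Lemma le_iid_expect n (F G : {ffun 'I_n -> I} -> R) :
  (forall a, F a <= G a) -> iid_expect F <= iid_expect G.
Proof.
by move=> FG; apply: ler_sum => a _; rewrite ler_wpM2l// prodr_ge0.
Qed.

Lemma iid_expectZ n c (F : {ffun 'I_n -> I} -> R) :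
  iid_expect (fun a => c * F a) = c * iid_expect F.
Proof. by rewrite /iid_expect mulr_sumr; apply: eq_bigr => a _; rewrite mulrCA. Qed.

Lemma iid_prob_le n (Q Q' : {ffun 'I_n -> I} -> bool) :
  (forall a, Q a -> Q' a) -> iid_prob Q <= iid_prob Q'.
Proof.
move=> QQ'; apply: le_iid_expect => a; rewrite ler_nat.
by have := QQ' a; case: (Q a) => // ->.
Qed.

Lemma iid_probU n (Q Q' : {ffun 'I_n -> I} -> bool) :
  iid_prob (fun a => Q a || Q' a) <= iid_prob Q + iid_prob Q'.
Proof.
rewrite /iid_prob /iid_expect -big_split /=; apply: ler_sum => a _.
rewrite -mulrDr ler_wpM2l ?prodr_ge0// -natrD ler_nat.
by case: (Q a); case: (Q' a).
Qed.

Lemma iid_prob_markov n c (Q : {ffun 'I_n -> I} -> bool) (G : {ffun 'I_n -> I} -> R) :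
  (forall a, 0 <= G a) -> (forall a, Q a -> 1 <= c * G a) -> 0 <= c ->
  iid_prob Q <= c * iid_expect G.
Proof.
move=> G0 QG c0; rewrite -iid_expectZ; apply: le_iid_expect => a.
have := QG a; case: (Q a) => [/(_ isT)//|_].
by rewrite mulr_ge0.
Qed.

(** Conditioning on the first draw. *)
Lemma iid_expect_recl n (V : zmodType) (f : I -> V) (G : V -> R) :
  @iid_expect n.+1 (fun a => G (\sum_t f (a t))) =
  \sum_i p i * @iid_expect n (fun a => G (f i + \sum_t f (a t))).
Proof.
pose h (ia : I * {ffun 'I_n -> I}) : {ffun 'I_n.+1 -> I} :=
  [ffun j => oapp ia.2 ia.1 (unlift ord0 j)].
pose h' (a : {ffun 'I_n.+1 -> I}) := (a ord0, [ffun j : 'I_n => a (lift ord0 j)]).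
have hK : cancel h h'.
  case=> i a; rewrite /h /h' ffunE unlift_none /=; congr (_, _).
  by apply/ffunP => j; rewrite !ffunE liftK.
have h'K : cancel h' h.
  move=> a; apply/ffunP => j; rewrite /h /h' ffunE /=.
  by case: unliftP => [k ->|->] //=; rewrite ffunE.
rewrite /iid_expect (reindex h) /=; last by exists h' => ? _; [exact: hK|exact: h'K].
under [RHS]eq_bigr do rewrite mulr_sumr.
rewrite pair_bigA /=; apply: eq_bigr => -[i a] _ /=.
rewrite !big_ord_recl mulrA; congr (_ * _ * G (_ + _)); rewrite /h ?ffunE ?unlift_none//=.
  by apply: eq_bigr => t _; rewrite ffunE liftK.
by apply: eq_bigr => t _; rewrite ffunE liftK.
Qed.

(** Chernoff's bound. Since W is nonnegative, exp(-y) <= 1 - y + y^2/2 for y >= 0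
    controls the exponential moment, and W^2 <= B W turns the second moment into
    the mean, whence the deviation sqrt(2 B v L). *)
Lemma iid_lower_tail n (W : I -> R) (B L : R) : (0 < n)%N -> 0 < B -> 0 < L ->
  (forall i, 0 <= W i <= B) -> 0 < \sum_i p i * W i ->
  @iid_prob n (fun a => n%:R^-1 * \sum_t W (a t) <
    \sum_i p i * W i - Num.sqrt (2 * B * (\sum_i p i * W i) * L)) <=
  expR (- (n%:R * L)).
Proof.
move=> n0 B0 L0 WB; set v := \sum_i p i * W i => v0.
set s := Num.sqrt _.
have s2 : s ^+ 2 = 2 * B * v * L by rewrite sqr_sqrtr// !mulr_ge0// ltW.
have s0 : 0 < s by rewrite sqrtr_gt0 !mulr_gt0.
have nR0 : 0 < n%:R :> R by rewrite ltr0n.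
(* The minimizer of - l s + l^2 B v / 2. *)
pose l := s / (B * v).
have l0 : 0 < l by rewrite divr_gt0 ?mulr_gt0.
have lBv : l * (B * v) = s by rewrite /l divfK// mulf_neq0 ?lt0r_neq0.
have mgf : \sum_i p i * expR (- (l * W i)) <= expR (- (l * v) + l * s / 2).
  apply: le_trans (expR_ge1Dx _).
  rewrite -lBv (_ : _ + _ = \sum_i p i * (1 - l * W i + l ^+ 2 * B * W i / 2)); last first.
    rewrite (eq_bigr (fun i => p i + (- l + l ^+ 2 * B / 2) * (p i * W i))); last first.
      by move=> i _; ring.
    by rewrite big_split /= p_sum1 -mulr_sumr -/v; field.
  apply: ler_sum => i _; rewrite ler_wpM2l//.
  have /andP[W0 W1] := WB i.
  apply: le_trans (expRN_le_quadratic _) _; first by rewrite mulr_ge0// ltW.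
  rewrite lerD2l ler_wpM2r// ?invr_ge0// exprMn -mulrA ler_wpM2l ?sqr_ge0//.
  by rewrite expr2 ler_wpM2r.
have E : @iid_expect n (fun a => expR (- (l * \sum_t W (a t)))) <=
    expR (- (l * v) + l * s / 2) ^+ n.
  apply: le_trans (_ : (\sum_i p i * expR (- (l * W i))) ^+ n <= _).
    rewrite -iid_expect_prod; apply: le_iid_expect => a.
    by rewrite mulr_sumr -sumrN expR_sum.
  by rewrite lerXn2r ?nnegrE ?expR_ge0 ?sumr_ge0// => i _; rewrite mulr_ge0 ?expR_ge0.
apply: (@le_trans _ _ (expR (l * (n%:R * (v - s))) *
    @iid_expect n (fun a => expR (- (l * \sum_t W (a t)))))).
  apply: iid_prob_markov => [a|a|]; rewrite ?expR_ge0//.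
  rewrite mulrC ltr_pdivrMr// => h.
  rewrite -expRD -{1}expR0 ler_expR -mulrBr mulr_ge0 ?ltW// subr_gt0.
  by rewrite mulrC.
apply: le_trans (ler_wpM2l (expR_ge0 _) E) _.
rewrite -expRM_natl -expRD ler_expR.
have -> : L = l * s / 2.
  apply: (@mulfI _ (2 * B * v)); first by rewrite !mulf_neq0 ?lt0r_neq0.
  by rewrite -s2 /l; field; rewrite !lt0r_neq0.
by rewrite le_eqVlt; apply/orP; left; apply/eqP; field.
Qed.

End product_law.
(** * Bernstein's inequality in a Hilbert space *)

Section hilbert_bernstein.
Context (R : realType) (V : normedModType R) (dot : {dot V for idfun}).
Hypothesis normE : forall f : V, `|f| ^+ 2 = dot f f.
Context (I : finType) (p : I -> R).
Hypothesis p_ge0 : forall i, 0 <= p i.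
Hypothesis p_sum1 : \sum_i p i = 1.

(** Induction on n, started at an arbitrary point x: averaging [coshR_normD] over
    the first draw multiplies by one factor, the linear term being killed by the
    centring of f. *)
Lemma iid_expect_coshR_le n (f : I -> V) (x : V) : \sum_i p i *: f i = 0 ->
  iid_expect p (fun a : {ffun 'I_n -> I} => coshR `|x + \sum_t f (a t)|) <=
  coshR `|x| * (\sum_i p i * (expR `|f i| - `|f i|)) ^+ n.
Proof.
move=> f0; elim: n x => [|n IH] x.
  rewrite /iid_expect; under eq_bigr do rewrite !big_ord0 mul1r addr0.
  by rewrite sumr_const card_ffun card_ord expn0 mulr1n expr0 mulr1.
rewrite (iid_expect_recl p n f (fun y => coshR `|x + y|)).
set C := \sum_i p i * (expR `|f i| - `|f i|).
have C0 : 0 <= C.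
  apply: sumr_ge0 => i _; rewrite mulr_ge0// subr_ge0.
  by apply: le_trans (expR_ge1Dx _); rewrite lerDr.
apply: (@le_trans _ _ (\sum_i p i * (coshR `|x + f i| * C ^+ n))).
  apply: ler_sum => i _; rewrite ler_wpM2l//.
  by apply: le_trans (IH (x + f i)); apply: le_iid_expect => // a; rewrite addrA.
under eq_bigr do rewrite mulrA.
rewrite -mulr_suml exprSr mulrA [leRHS]mulrAC ler_wpM2r ?exprn_ge0//.
apply: (@le_trans _ _ (\sum_i p i * (coshR `|x| * (expR `|f i| - `|f i|)
    + sinhR `|x| / `|x| * dot x (f i)))).
  by apply: ler_sum => i _; rewrite ler_wpM2l// coshR_normD.
under eq_bigr do rewrite mulrDr mulrCA [X in _ + X]mulrCA -(dotZr dot).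
by rewrite big_split /= -!mulr_sumr -dot_sumr f0 dot0r mulr0 addr0.
Qed.

(** The exponential moment bound with exp y - y - 1 <= (y^2/2) / (1 - y/3) gives a
    sub-gamma tail of variance n v and scale M/3. The bound v on the variance is
    required to be positive but need not be attained, so that a degenerate law is
    covered by taking v larger than its variance. *)
Lemma iid_norm_tail n (f : I -> V) (M v L : R) :
  \sum_i p i *: f i = 0 -> (0 < n)%N -> 0 <= M -> 0 < v -> 0 < L ->
  (forall i, `|f i| <= M) -> \sum_i p i * `|f i| ^+ 2 <= v ->
  iid_prob p (fun a : {ffun 'I_n -> I} =>
    Num.sqrt (2 * v * L) + M / 3 * L < n%:R^-1 * `|\sum_t f (a t)|) <=
  2 * expR (- (n%:R * L)).
Proof.
move=> f0 n0 M0 v0 L0 fM fv.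
have nR0 : 0 < n%:R :> R by rewrite ltr0n.
have [c cE] : exists c, c = M / 3 by exists (M / 3).
rewrite -cE; have c0 : 0 <= c by rewrite cE divr_ge0.
pose sg := Num.sqrt v; pose l2 := Num.sqrt (2 * L).
have sg0 : 0 < sg by rewrite sqrtr_gt0.
have l20 : 0 < l2 by rewrite sqrtr_gt0 mulr_gt0.
have sgE : v = sg ^+ 2 by rewrite sqr_sqrtr// ltW.
have LE : L = l2 ^+ 2 / 2 by rewrite sqr_sqrtr ?mulr_ge0// ?ltW//; field.
have -> : Num.sqrt (2 * v * L) = sg * l2.
  by rewrite /sg /l2 -sqrtrM ?(ltW v0)//; congr Num.sqrt; ring.
pose D := sg + c * l2; have D0 : 0 < D by rewrite ltr_wpDr ?mulr_ge0// ltW.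
(* For this l the exponent - l n (sg l2 + c L) + n l^2 v / (2 (1 - c l)) is exactly
   - n L. *)
pose l := l2 / D; have l0 : 0 < l by rewrite divr_gt0.
pose w := 1 - c * l.
have wE : w = sg / D by rewrite /w /l /D; field; exact: lt0r_neq0.
have w0 : 0 < w by rewrite wE divr_gt0.
pose e := l ^+ 2 * v / (2 * w).
have mgf : \sum_i p i * (expR `|l *: f i| - `|l *: f i|) <= expR e.
  apply: le_trans (expR_ge1Dx _).
  apply: (@le_trans _ _ (\sum_i p i * (1 + l ^+ 2 * `|f i| ^+ 2 / (2 * w)))).
    apply: ler_sum => i _; rewrite ler_wpM2l//.
    rewrite normrZ (gtr0_norm l0) -exprMn; set y := l * _.
    have y0 : 0 <= y by rewrite mulr_ge0// ltW.
    rewrite -lerBlDl ler_pdivlMr ?mulr_gt0//.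
    have h := expR_bernstein y0.
    have g0 : 0 <= expR y - y - 1 by rewrite -addrA -opprD subr_ge0 addrC expR_ge1Dx.
    have : w * (expR y - y - 1) <= (1 - y / 3) * (expR y - y - 1).
      rewrite ler_wpM2r// /w cE lerD2l lerN2 /y.
      by rewrite (mulrC l) [leLHS]mulrAC !ler_wpM2r ?invr_ge0// ltW.
    by lra.
  rewrite (eq_bigr (fun i => p i + l ^+ 2 / (2 * w) * (p i * `|f i| ^+ 2))); last first.
    by move=> i _; ring.
  rewrite big_split /= p_sum1 -mulr_sumr lerD2l /e [leRHS]mulrAC ler_wpM2l//.
  by rewrite divr_ge0 ?sqr_ge0// mulr_ge0// ltW.
have E : iid_expect p (fun a : {ffun 'I_n -> I} => coshR (l * `|\sum_t f (a t)|)) <=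
    expR e ^+ n.
  have lf0 : \sum_i p i *: (l *: f i) = 0.
    under eq_bigr do rewrite scalerA mulrC -scalerA.
    by rewrite -scaler_sumr f0 scaler0.
  have := iid_expect_coshR_le n 0 lf0.
  rewrite normr0 {2}/coshR oppr0 expR0 divff ?mul1r// => h.
  apply: (le_trans (le_trans _ h)).
    apply: le_iid_expect => // a.
    by rewrite add0r -scaler_sumr normrZ (gtr0_norm l0).
  rewrite lerXn2r ?nnegrE ?expR_ge0// sumr_ge0// => i _; rewrite mulr_ge0// subr_ge0.
  by apply: le_trans (expR_ge1Dx _); rewrite lerDr.
apply: (@le_trans _ _ (2 * expR (- (l * (n%:R * (sg * l2 + c * L)))) *
    iid_expect p (fun a : {ffun 'I_n -> I} => coshR (l * `|\sum_t f (a t)|)))).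
  apply: iid_prob_markov => // [a|a]; first exact/ltW/coshR_gt0.
  rewrite ltr_pdivlMl// => h.
  rewrite mulrAC expRN ler_pdivlMr ?expR_gt0// mul1r.
  apply: le_trans (expR_le_2coshR _); rewrite ler_expR ler_wpM2l ?(ltW l0)//.
  exact: ltW.
rewrite -!mulrA ler_pM2l//.
apply: le_trans (ler_wpM2l (expR_ge0 _) E) _.
rewrite -expRM_natl -expRD ler_expR le_eqVlt; apply/orP; left; apply/eqP.
rewrite /e wE sgE LE /l; have Dn := lt0r_neq0 D0; have sgn := lt0r_neq0 sg0.
have Dn' := Dn; rewrite /D in Dn' *.
by field; rewrite Dn' sgn.
Qed.

End hilbert_bernstein.
(** * The empirical Bernstein bound for finitely many atoms *)

(** From the variance to the empirical variance, as an inequality between numbers: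
    m stands for the mean of the |xi_t|^2 and vh for the empirical variance. With
    s = sqrt v, k = sqrt K, q = sqrt L the hypotheses read 3kq < s <= k, whence
    q <= 1/3, and m - e^2 >= (s - 3kq)^2 follows. The loss of 3kq in sqrt(vh) costs
    3 sqrt 2 * k L, which together with sqrt 2 / 3 * k L stays below 16/3 * k L. *)
Lemma empirical_sd_bound (R : realType) (K L v m e vh : R) :
  0 < K -> 0 < L -> 9 * K * L < v -> v <= K -> 0 <= e ->
  e <= Num.sqrt (2 * v * L) + Num.sqrt (2 * K) / 3 * L ->
  v - Num.sqrt (4 * K * v * L) <= m ->
  (0 <= m - e ^+ 2 -> m - e ^+ 2 <= vh) ->
  e <= Num.sqrt (2 * vh * L) + 16 / 3 * Num.sqrt K * L.
Proof.
move=> K0 L0 vKL vK e0.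
have v0 : 0 < v by apply: lt_trans vKL; rewrite !mulr_gt0.
set k := Num.sqrt K; pose s := Num.sqrt v; pose q := Num.sqrt L; pose r := Num.sqrt (2 : R).
have k0 : 0 < k by rewrite sqrtr_gt0.
have s0 : 0 < s by rewrite sqrtr_gt0.
have q0 : 0 < q by rewrite sqrtr_gt0.
have r0 : 0 <= r by rewrite sqrtr_ge0.
have kE : K = k ^+ 2 by rewrite sqr_sqrtr// ltW.
have sE : v = s ^+ 2 by rewrite sqr_sqrtr// ltW.
have qE : L = q ^+ 2 by rewrite sqr_sqrtr// ltW.
have r2 : r ^+ 2 = 2 by rewrite sqr_sqrtr.
have r85 : r <= 8 / 5 by rewrite -(@ler_pXn2r _ 2)// ?nnegrE// r2 expr2; lra.
have -> : Num.sqrt (2 * v * L) = r * s * q by rewrite !sqrtrM ?mulr_ge0// ltW.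
have -> : Num.sqrt (2 * K) = r * k by rewrite sqrtrM.
have -> : Num.sqrt (4 * K * v * L) = 2 * k * s * q.
  rewrite (_ : 4 * K * v * L = (2 * k * s * q) ^+ 2); last by rewrite kE sE qE; ring.
  by rewrite sqrtr_sqr ger0_norm// !mulr_ge0// ltW.
have sk : s <= k by rewrite ler_wsqrtr.
have skq : 3 * k * q < s.
  rewrite -(@ltr_pXn2r _ 2)// ?nnegrE ?mulr_ge0 ?ltW//.
  by rewrite -sE; apply: le_lt_trans vKL; rewrite kE qE; lra.
have q3 : q <= 1 / 3.
  rewrite -(ler_pM2l k0); lra.
move=> eb mb vhb.
have sq0 : 0 <= s - 3 * k * q by rewrite subr_ge0 ltW.
have main : (s - 3 * k * q) ^+ 2 <= m - e ^+ 2.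
  have e2 : e ^+ 2 <= (r * s * q + r * k / 3 * L) ^+ 2.
    by rewrite lerXn2r ?nnegrE//; apply: le_trans eb.
  have E : (r * s * q + r * k / 3 * L) ^+ 2 = 2 * q ^+ 2 * (s + k * q / 3) ^+ 2.
    by rewrite -r2 qE; ring.
  have h1 : s + k * q / 3 <= 10 / 9 * s by lra.
  have h2 : (s + k * q / 3) ^+ 2 <= (10 / 9 * s) ^+ 2.
    have kq0 := mulr_gt0 k0 q0.
    by rewrite lerXn2r ?nnegrE//; lra.
  have h3 : 2 * q * (s + k * q / 3) ^+ 2 <= k * s.
    apply: (@le_trans _ _ (2 * q * (10 / 9 * s) ^+ 2)).
      by rewrite ler_wpM2l ?mulr_ge0// ltW.
    have : q * (s * s) <= 1 / 3 * (k * s).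
      apply: ler_pM; [exact: ltW|by rewrite mulr_ge0 ?ltW|by []|].
      by rewrite ler_wpM2r ?(ltW s0).
    have : 0 < k * s by rewrite mulr_gt0.
    rewrite expr2; lra.
  have h4 : 3 * k * q * k <= s * k by rewrite ler_wpM2r ?(ltW k0) ?ltW.
  have h5 : q * (2 * q * (s + k * q / 3) ^+ 2) <= q * (4 * k * s - 9 * k * k * q).
    by rewrite ler_wpM2l ?(ltW q0)//; apply: (le_trans h3); lra.
  apply: (@le_trans _ _ (s ^+ 2 - 2 * k * s * q - 2 * q ^+ 2 * (s + k * q / 3) ^+ 2)).
    by rewrite -subr_ge0; move: h5; rewrite -subr_ge0 => h5; apply: le_trans h5 _; lra.
  by rewrite -E -sE lerB.
have vh1 : (s - 3 * k * q) ^+ 2 <= vh.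
  by apply: (le_trans main); apply: vhb; apply: le_trans main; rewrite sqr_ge0.
apply: (le_trans eb).
apply: (@le_trans _ _ (r * (s - 3 * k * q) * q + 16 / 3 * k * L)).
  have : r * (k * L) <= 8 / 5 * (k * L) by rewrite ler_wpM2r ?(mulr_ge0 (ltW k0) (ltW L0)).
  have : 0 < k * L by rewrite mulr_gt0.
  by rewrite qE; lra.
rewrite lerD2r.
rewrite [leLHS](_ : _ = Num.sqrt (2 * (s - 3 * k * q) ^+ 2 * L)).
  by rewrite ler_wsqrtr// ler_wpM2r ?(ltW L0)// ler_wpM2l.
by rewrite sqrtrM ?mulr_ge0 ?sqr_ge0// sqrtrM// sqrtr_sqr ger0_norm.
Qed.

Section finite_empirical_bernstein.
Context (R : realType) (V : normedModType R) (dot : {dot V for idfun}).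
Hypothesis normE : forall f : V, `|f| ^+ 2 = dot f f.
Context (I : finType) (p : I -> R).
Hypothesis p_ge0 : forall i, 0 <= p i.
Hypothesis p_sum1 : \sum_i p i = 1.
Context (Y : I -> V) (K : R).
Hypothesis Y_osc : forall i j l m, dot (Y i) (Y j) - dot (Y l) (Y m) <= K.

Let mu := \sum_i p i *: Y i.
Let v := \sum_i p i * `|Y i - mu| ^+ 2.

Let p_avg (c : R) : \sum_i p i * c = c.
Proof. by rewrite -mulr_suml p_sum1 mul1r. Qed.

Let p_le (F : I -> R) c : (forall i, F i <= c) -> \sum_i p i * F i <= c.
Proof. by move=> Fc; rewrite -[leRHS]p_avg; apply: ler_sum => i _; rewrite ler_wpM2l. Qed.

Lemma dot_mean i : dot (Y i) mu = \sum_j p j * dot (Y i) (Y j).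
Proof. by rewrite dot_sumr; apply: eq_bigr => j _; rewrite dotZr. Qed.

Lemma dot_mean_mean : dot mu mu = \sum_i p i * dot (Y i) mu.
Proof. by rewrite dot_suml; apply: eq_bigr => j _; rewrite dotZl. Qed.

(** The left side is the average, over two independent draws j and l, of
    (Y_ii - Y_ij) + (Y_jl - Y_ij), writing Y_ij for the inner products. *)
Lemma sqr_norm_dev i : `|Y i - mu| ^+ 2 <= 2 * K.
Proof.
rewrite (sqr_normB normE) !normE dot_mean_mean dot_mean.
rewrite [leLHS](_ : _ = \sum_j p j * (dot (Y i) (Y i) - 2 * dot (Y i) (Y j) + dot (Y j) mu)).
  apply: p_le => j; rewrite dot_mean.
  rewrite [leLHS](_ : _ = \sum_l p l *
      (dot (Y i) (Y i) - 2 * dot (Y i) (Y j) + dot (Y j) (Y l))).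
    apply: p_le => l; have := Y_osc i i i j; have := Y_osc j l i j; lra.
  under [RHS]eq_bigr do rewrite mulrDr.
  by rewrite big_split /= p_avg.
under [RHS]eq_bigr do rewrite mulrDr mulrBr mulrCA.
rewrite big_split /= sumrB p_avg -mulr_sumr; ring.
Qed.

(** v is the average of Y_ii - Y_ij over two independent draws i and j. *)
Lemma variance_le : v <= K.
Proof.
rewrite /v [leLHS](_ : _ = \sum_i p i * (dot (Y i) (Y i) - dot (Y i) mu)).
  apply: p_le => i; rewrite dot_mean.
  rewrite [leLHS](_ : _ = \sum_j p j * (dot (Y i) (Y i) - dot (Y i) (Y j))).
    by apply: p_le => j; exact: Y_osc.
  under [RHS]eq_bigr do rewrite mulrBr.
  by rewrite sumrB p_avg.
under eq_bigr do rewrite (sqr_normB normE) !normE mulrBr mulrDr mulrCA.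
rewrite sumrB big_split /= p_avg -mulr_sumr -dot_mean_mean.
under [RHS]eq_bigr do rewrite mulrBr.
rewrite sumrB -dot_mean_mean; ring.
Qed.

Lemma mean_dev n (a : 'I_n -> I) : (0 < n)%N ->
  n%:R^-1 *: \sum_t Y (a t) - mu = n%:R^-1 *: \sum_t (Y (a t) - mu).
Proof.
move=> n0; rewrite sumrB sumr_const card_ord scalerBr -(scaler_nat n mu) scalerA.
by rewrite mulVf ?scale1r// pnatr_eq0 -lt0n.
Qed.

(** The empirical variance is the centred second moment about the empirical mean,
    here expanded about the true mean. *)
Lemma vhat_dev n (a : 'I_n -> I) : (1 < n)%N ->
  vhat (fun i j => dot (Y i) (Y j)) a = (n%:R - 1)^-1 * (n%:R *
   (n%:R^-1 * \sum_t `|Y (a t) - mu| ^+ 2 - `|n%:R^-1 *: \sum_t Y (a t) - mu| ^+ 2)).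
Proof.
move=> n1; have nn0 : n%:R != 0 :> R by rewrite pnatr_eq0; case: n n1 a.
rewrite /vhat; congr (_ * _); set S := \sum_t Y (a t).
under eq_bigr do rewrite -dot_sumr -/S.
rewrite sumrB -mulr_sumr -dot_suml -/S.
under [in RHS]eq_bigr do rewrite (sqr_normB normE) normE.
rewrite sumrB big_split /= sumr_const card_ord -mulr_sumr -dot_suml -/S.
rewrite (sqr_normB normE) !normE !(dotZr, dotZl) -mulr_natl.
by field.
Qed.

(** Small variance v <= 9KL is treated by the norm tail alone, with 9KL as the
    bound on the variance; otherwise the norm tail and the lower tail of the
    squared deviations are combined by [empirical_sd_bound]. *)
Lemma finite_empirical_bernstein n (L : R) : (1 < n)%N -> 0 < L ->
  iid_prob p (fun a : {ffun 'I_n -> I} =>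
    Num.sqrt (2 * vhat (fun i j => dot (Y i) (Y j)) a * L) + 16 / 3 * Num.sqrt K * L <
    `|n%:R^-1 *: \sum_t Y (a t) - mu|) <= 3 * expR (- (n%:R * L)).
Proof.
move=> n1 L0; have n0 : (0 < n)%N by exact: ltnW.
have nR : 1 < n%:R :> R by rewrite ltr1n.
have nR0 : 0 < n%:R :> R by rewrite ltr0n.
set dev := fun a : {ffun 'I_n -> I} => `|n%:R^-1 *: \sum_t Y (a t) - mu|.
have devE a : dev a = n%:R^-1 * `|\sum_t (Y (a t) - mu)|.
  by rewrite /dev mean_dev// normrZ ger0_norm// invr_ge0 ler0n.
have i0 : I.
  case: (pickP I) => // I0; have := p_sum1; rewrite big_pred0// => /eqP.
  by rewrite eq_sym oner_eq0.
have K0 : 0 <= K by have := Y_osc i0 i0 i0 i0; rewrite subrr.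
have xi0 : \sum_i p i *: (Y i - mu) = 0.
  under eq_bigr do rewrite scalerBr.
  by rewrite sumrB -scaler_suml p_sum1 scale1r subrr.
have e3 : 0 < expR (- (n%:R * L)) by exact: expR_gt0.
pose M := Num.sqrt (2 * K).
have xiM i : `|Y i - mu| <= M.
  by rewrite -(ger0_norm (normr_ge0 (Y i - mu))) -sqrtr_sqr ler_wsqrtr// sqr_norm_dev.
have tail w : 0 < w -> v <= w -> iid_prob p (fun a : {ffun 'I_n -> I} =>
    Num.sqrt (2 * w * L) + M / 3 * L < dev a) <= 2 * expR (- (n%:R * L)).
  move=> w0 vw; rewrite (_ : (fun a => _) = (fun a : {ffun 'I_n -> I} =>
      Num.sqrt (2 * w * L) + M / 3 * L < n%:R^-1 * `|\sum_t (Y (a t) - mu)|)).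
    have M0 : 0 <= M by exact: sqrtr_ge0.
    exact: (iid_norm_tail normE p_ge0 p_sum1 xi0 n0 M0 w0 L0 xiM vw).
  by apply/funext => a; rewrite devE.
have kL0 : 0 <= Num.sqrt K * L by rewrite mulr_ge0// ltW.
(* K = 0: all atoms coincide, and the deviation is identically 0. *)
have [K00|Kpos] := eqVneq K 0.
  apply: le_trans (_ : iid_prob p (fun a : {ffun 'I_n -> I} => false) <= _).
    apply: iid_prob_le => // a; rewrite -/(dev a) devE.
    rewrite big1 ?normr0 ?mulr0; last first.
      move=> t _; apply/eqP; rewrite -normr_le0; apply: (le_trans (xiM _)).
      by rewrite /M K00 mulr0 sqrtr0.
    apply: contraTT => _; rewrite -leNgt addr_ge0 ?sqrtr_ge0//.
    by rewrite -mulrA mulr_ge0.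
  rewrite /iid_prob /iid_expect big1 ?mulr_ge0 ?ltW// => a _; exact: mulr0.
have {Kpos}K1 : 0 < K by rewrite lt_neqAle eq_sym Kpos.
have [vKL|vKL] := leP v (9 * K * L).
  apply: (@le_trans _ _ (2 * expR (- (n%:R * L)))); last by rewrite ler_pM2r//; lra.
  apply: le_trans (tail _ _ vKL); last by rewrite !mulr_gt0.
  apply: iid_prob_le => // a; rewrite -/(dev a); apply: le_lt_trans.
  have r85 : Num.sqrt (2 : R) <= 8 / 5.
    by rewrite -(@ler_pXn2r _ 2)// ?nnegrE ?sqrtr_ge0// sqr_sqrtr// expr2; lra.
  apply: (@le_trans _ _ (16 / 3 * Num.sqrt K * L)); last by rewrite lerDr sqrtr_ge0.
  have -> : Num.sqrt (2 * (9 * K * L) * L) = Num.sqrt 2 * (3 * (Num.sqrt K * L)).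
    rewrite (_ : 2 * (9 * K * L) * L = 2 * (K * (3 * L) ^+ 2)); last by ring.
    by rewrite sqrtrM// (sqrtrM _ (ltW K1)) sqrtr_sqr ger0_norm ?mulr_ge0 ?(ltW L0)//; ring.
  rewrite /M sqrtrM//.
  have := ler_wpM2r kL0 r85; lra.
have v0 : 0 < v by apply: lt_trans vKL; rewrite !mulr_gt0.
have WB i : 0 <= `|Y i - mu| ^+ 2 <= 2 * K by rewrite sqr_ge0 sqr_norm_dev.
have K20 : 0 < 2 * K by rewrite mulr_gt0.
have lower := iid_lower_tail p_ge0 p_sum1 n0 K20 L0 WB v0.
rewrite (_ : 3 * expR _ = 2 * expR (- (n%:R * L)) + expR (- (n%:R * L))); last by ring.
apply: le_trans (lerD (tail v v0 (lexx v)) lower).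
apply: le_trans (iid_probU p_ge0 _ _).
apply: iid_prob_le => // a; rewrite -/(dev a); apply: contraTT.
rewrite negb_or -!leNgt => /andP[h1 h2].
apply: (@empirical_sd_bound R K L v (n%:R^-1 * \sum_t `|Y (a t) - mu| ^+ 2)) => //.
- exact: variance_le.
- exact: normr_ge0.
- by rewrite (_ : 4 * K = 2 * (2 * K)) //; ring.
move=> h0; rewrite vhat_dev// ler_pdivlMl ?subr_gt0// ler_wpM2r//.
by lra.
Qed.

End finite_empirical_bernstein.
(** * Finite-valued maps and the Bochner integral *)

Section finite_valued.
Context (d : measure_display) (T : measurableType d) (R : realType) (mu : probability T R).

Definition cell_prob (I : finType) (J : T -> I) (i : I) : R := fine (mu (J @^-1` [set i])).

Section one_map.
Context (I : finType) (J : T -> I).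
Hypothesis mJ : forall i, measurable (J @^-1` [set i]).

Lemma cell_prob_ge0 i : 0 <= cell_prob J i.
Proof. exact: fine_ge0. Qed.

Lemma cell_probE i : mu (J @^-1` [set i]) = (cell_prob J i)%:E.
Proof. by rewrite fineK// fin_num_measure. Qed.

Lemma preimage_cells (Q : pred I) :
  [set x | Q (J x)] = \bigcup_(i in [set` Q]) (J @^-1` [set i]).
Proof. by apply/seteqP; split => [x Qx|x [i /= Qi ->]//]; exists (J x). Qed.

Lemma measurable_preimage_cells (Q : pred I) : measurable [set x | Q (J x)].
Proof. by rewrite preimage_cells; apply: fin_bigcup_measurable => //; exact: finite_finset. Qed.

Lemma measure_preimage_cells (Q : pred I) :
  mu [set x | Q (J x)] = (\sum_(i | Q i) cell_prob J i)%:E.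
Proof.
rewrite preimage_cells measure_fin_bigcup//; last first.
  by move=> i j _ _ [x [/= <- <-]].
rewrite (@fsbig_fwiden _ _ _ _ (enum Q)) ?enum_uniq//.
- by rewrite big_enum /= -sumEFin; apply: eq_bigr => i _; rewrite cell_probE.
- by move=> i /= Qi; rewrite mem_enum.
- by move=> i [/=]; rewrite mem_enum => Qi /(_ Qi).
Qed.

Lemma sum_cell_prob : \sum_i cell_prob J i = 1.
Proof.
have := measure_preimage_cells predT; rewrite [X in mu X](_ : _ = setT).
  by rewrite probability_setT => -[].
exact/seteqP.
Qed.

Lemma measurable_cells_fun (F : I -> R) : measurable_fun setT (F \o J).
Proof.
move=> _ B mB; rewrite setTI.
rewrite (_ : _ @^-1` _ = [set x | F (J x) \in B]).
  exact: (measurable_preimage_cells (fun i => F i \in B)).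
by apply/seteqP; split => x /=; rewrite inE.
Qed.

Lemma ge0_integral_cells (F : I -> R) : (forall i, 0 <= F i) ->
  (\int[mu]_x (F (J x))%:E = (\sum_i cell_prob J i * F i)%:E)%E.
Proof.
move=> F0.
transitivity (\int[mu]_x (\sum_(i <- enum I) (F i)%:E * (\1_(J @^-1` [set i]) x)%:E))%E.
  apply: eq_integral => x _; rewrite big_enum /= (bigD1 (J x))//= indicE mem_set// mule1.
  rewrite big1 ?adde0// => i /negPf iJ.
  rewrite indicE memNset ?mule0//= => Ji; by rewrite Ji eqxx in iJ.
have mI i : measurable_fun setT (fun x => (\1_(J @^-1` [set i]) x)%:E : \bar R).
  by apply/measurable_EFinP; exact: measurable_indic.
rewrite ge0_integral_sum//; last 2 first.
  by move=> i; apply: emeasurable_funM.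
  by move=> i x _; rewrite mule_ge0// lee_fin// indicE.
rewrite big_enum /= -sumEFin; apply: eq_bigr => i _.
rewrite ge0_integralZl ?lee_fin//.
rewrite integral_indic// setIT mulrC EFinM; congr (_ * _)%E.
exact: cell_probE.
Qed.

(** The integral of a simple function may be computed from any finite measurable
    partition on whose cells it is constant, the cells not having to carry distinct
    values. This allows two simple functions to share a partition. *)
Lemma bochner_sintegral_cells (E : normedModType R) (Y : I -> E) (s : {fimfun T >-> E}) :
  (forall x, s x = Y (J x)) -> bochner_sintegral mu s = \sum_i cell_prob J i *: Y i.
Proof.
move=> sE; pose r := undup [seq Y i | i <- enum I].
rewrite /bochner_sintegral (@fsbigE _ _ _ _ _ r) ?undup_uniq//; last first.
  move=> y _ yr; rewrite [X in mu X](_ : _ = set0) ?measure0 ?scale0r//.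
  apply/seteqP; split => // x /= sx; case/negP: yr.
  by rewrite mem_undup -sx sE map_f// mem_enum.
transitivity (\sum_(y <- r) \sum_(i | Y i == y) cell_prob J i *: Y i).
  rewrite big_mkcond /=; apply: eq_bigr => y _; rewrite in_setT.
  rewrite (_ : s @^-1` [set y] = [set x | Y (J x) == y]); last first.
    by apply/seteqP; split => x /=; rewrite sE => /eqP.
  rewrite (measure_preimage_cells (fun i => Y i == y)) /= scaler_suml.
  by apply: eq_bigr => i /eqP ->.
rewrite (exchange_big_dep predT)//=; apply: eq_bigr => i _.
rewrite big_mkcond (bigD1_seq (Y i)) ?undup_uniq//=; last first.
  by rewrite mem_undup map_f// mem_enum.
by rewrite eqxx big1 ?addr0// => y; rewrite eq_sym => /negPf ->.
Qed.

End one_map.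
End finite_valued.
Section bochner_uniqueness.
Context (d : measure_display) (T : measurableType d) (R : realType) (mu : probability T R).
Context (E : normedModType R).
Implicit Types (s : {fimfun T >-> E}) (f : T -> E).

Lemma bochner_simple_cells s : bochner_simple s ->
  exists (I : finType) (J : T -> I) (Y : I -> E),
    (forall i, measurable (J @^-1` [set i])) /\ (forall x, s x = Y (J x)).
Proof.
move=> ms; have /finite_seqP[r rE] := @fimfunP _ _ s.
have sr x : s x \in r by have : range s (s x) by []; rewrite rE.
exists (seq_sub r), (fun x => SeqSub (sr x)), val; split => // i.
rewrite (_ : _ @^-1` _ = s @^-1` [set val i]); first exact: ms.
by apply/seteqP; split => x /= => [<-//|sx]; exact: val_inj.
Qed.

Lemma measurable_norm_sub_cells (I : finType) (J : T -> I) (Y : I -> E) f :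
  (forall i, measurable (J @^-1` [set i])) ->
  (forall y, measurable_fun setT (fun x => `|f x - y|)) ->
  measurable_fun setT (fun x => `|f x - Y (J x)|).
Proof.
move=> mJ mf.
rewrite (_ : (fun x => _) =
    (fun x => \sum_(i <- enum I) `|f x - Y i| * \1_(J @^-1` [set i]) x)).
  by apply: measurable_sum => i; apply: measurable_funM => //; exact: measurable_indic.
apply/funext => x; rewrite big_enum /= (bigD1 (J x))//= indicE mem_set// mulr1.
rewrite big1 ?addr0// => i /negPf iJ.
by rewrite indicE memNset ?mulr0//= => Ji; rewrite Ji eqxx in iJ.
Qed.

Lemma measurable_norm_sub_simple f s : bochner_simple s ->
  (forall y, measurable_fun setT (fun x => `|f x - y|)) ->
  measurable_fun setT (fun x => `|f x - s x|).
Proof.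
move=> /bochner_simple_cells[I [J [Y [mJ sE]]]] mf.
by under eq_fun do rewrite sE; exact: measurable_norm_sub_cells.
Qed.

(** Common refinement of the two partitions, then the triangle inequality through
    f. This single estimate yields both the uniqueness of the Bochner integral and
    the Cauchy property behind its existence. *)
Lemma bochner_sintegral_dist f s s' :
  (forall y, measurable_fun setT (fun x => `|f x - y|)) ->
  bochner_simple s -> bochner_simple s' ->
  ((`|bochner_sintegral mu s - bochner_sintegral mu s'|)%:E <=
   \int[mu]_x (`|f x - s x|)%:E + \int[mu]_x (`|f x - s' x|)%:E)%E.
Proof.
move=> mf ms ms'.
have mfs := measurable_norm_sub_simple ms mf.
have mfs' := measurable_norm_sub_simple ms' mf.
have [I [J [Y [mJ sE]]]] := bochner_simple_cells ms.
have [I' [J' [Y' [mJ' sE']]]] := bochner_simple_cells ms'.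
pose J2 x := (J x, J' x).
have mJ2 i : measurable (J2 @^-1` [set i]).
  rewrite (_ : _ @^-1` _ = J @^-1` [set i.1] `&` J' @^-1` [set i.2]).
    exact: measurableI.
  by apply/seteqP; split => x; case: i => i i' /=; rewrite /J2 => -[<- <-].
rewrite (bochner_sintegral_cells mu mJ2 (Y := Y \o fst))//.
rewrite (bochner_sintegral_cells mu mJ2 (Y := Y' \o snd))//.
rewrite -sumrB /=.
apply: (@le_trans _ _ (\sum_i cell_prob mu J2 i * `|Y i.1 - Y' i.2|)%:E).
  rewrite lee_fin; apply: le_trans (ler_norm_sum _ _ _) _.
  by apply: ler_sum => i _; rewrite -scalerBr normrZ ger0_norm// cell_prob_ge0.
rewrite -(ge0_integral_cells mu mJ2 (F := fun i => `|Y i.1 - Y' i.2|))//.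
rewrite -ge0_integralD//; [|exact/measurable_EFinP..].
apply: ge0_le_integral => //.
- by apply/measurable_EFinP; exact: (measurable_cells_fun mJ2 (fun i => `|Y i.1 - Y' i.2|)).
- by apply: emeasurable_funD; exact/measurable_EFinP.
move=> x _; rewrite -EFinD lee_fin /= -sE -sE'.
rewrite (_ : s x - s' x = (f x - s' x) - (f x - s x)); last first.
  by rewrite opprB [RHS]addrC addrA subrK.
by apply: le_trans (ler_normB _ _) _; rewrite addrC.
Qed.

Lemma has_bochner_integral_unique f v v' :
  (forall y, measurable_fun setT (fun x => `|f x - y|)) ->
  has_bochner_integral mu f v -> has_bochner_integral mu f v' -> v = v'.
Proof.
move=> mf [s [ms _ s0 sv]] [s' [ms' _ s0' sv']].
apply/eqP; rewrite -subr_eq0 -normr_le0.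
have c1 : (`|bochner_sintegral mu (s n) - bochner_sintegral mu (s' n)|)%:E @[n --> \oo]
    --> (`|v - v'|)%:E.
  by apply: cvg_EFin; [near=> n|apply: cvg_norm; apply: cvgB].
have c2 : (\int[mu]_x (`|f x - s n x|)%:E + \int[mu]_x (`|f x - s' n x|)%:E)%E
    @[n --> \oo] --> 0%E.
  by rewrite -[X in _ --> X]adde0; apply: cvgeD.
rewrite -lee_fin; apply: (lee_cvg_to c1 c2).
by near=> n; apply: bochner_sintegral_dist.
Unshelve. all: by end_near. Qed.

End bochner_uniqueness.
(** * Quantization of a continuous map on a separable space *)

Lemma continuous_measurable_borel (R : realType) (X : ptopologicalType) (f : X -> R) :
  continuous f -> measurable_fun setT (f : borel X -> R).
Proof.
move=> /continuousP cf; apply: (measurability _ (RGenOpens.measurableE R)).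
move=> _ [_ [a [b ->] <-]]; rewrite setTI.
by apply: sub_sigma_algebra; exact/cf/interval_open.
Qed.

Lemma separable_dense_seq (R : realType) (X : ptopologicalType) (E : normedModType R)
    (Phi : X -> E) : separable X -> continuous Phi ->
  exists u : nat -> X, forall x (e : R), 0 < e -> exists j, `|Phi x - Phi (u j)| < e.
Proof.
move=> [D /countable_injP[g ginj] dD] /continuousP cP.
exists (fun j => xget point [set y | D y /\ g y = j]) => x e e0.
have [|y [/= yb Dy]] := dD (Phi @^-1` ball (Phi x) e) _ (cP _ (ball_open _ _)).
  by exists x; exact: ballxx.
exists (g y); move: yb; rewrite -ball_normE /ball_ /=.
case: xgetP => [z zE [Dz gz]|/(_ y)]; last by case.
by have -> : z = y by apply: ginj; rewrite ?inE.
Qed.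

Section nearest_point.
Context (R : realType) (X : ptopologicalType) (E : completeNormedModType R).
Context (Phi : X -> E) (u : nat -> X).
Hypothesis Phi_cont : continuous Phi.

(** Index, among the first m + 1 points of the sequence, of a point whose image is
    nearest to Phi x. The recursion keeps the smallest such index, which makes the
    choice measurable. *)
Fixpoint nearest (m : nat) (x : X) : nat :=
  if m is m'.+1 then
    if `|Phi x - Phi (u m)| < `|Phi x - Phi (u (nearest m' x))| then m else nearest m' x
  else 0%N.

Definition nearest_ord m (x : X) : 'I_m.+1 := inord (nearest m x).

Definition quantize m (x : X) : E := Phi (u (nearest m x)).

Lemma nearest_le m x : (nearest m x <= m)%N.
Proof. by elim: m => //= m IH; case: ifP => // _; apply: leq_trans IH _. Qed.

Lemma nearest_ordE m x : nearest_ord m x = nearest m x :> nat.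
Proof. by rewrite inordK// ltnS nearest_le. Qed.

Lemma preimage_nearest_ord m (i : 'I_m.+1) :
  nearest_ord m @^-1` [set i] = nearest m @^-1` [set val i].
Proof.
apply/seteqP; split => x /= => [<-|h]; first by rewrite nearest_ordE.
by apply/val_inj; rewrite /= nearest_ordE.
Qed.

Lemma quantize_min m j x : (j <= m)%N -> `|Phi x - quantize m x| <= `|Phi x - Phi (u j)|.
Proof.
rewrite /quantize; elim: m => [|m IH]; first by rewrite leqn0 => /eqP ->.
rewrite leq_eqVlt => /predU1P[->|]; rewrite /=; case: ifPn => //.
  by rewrite -leNgt.
move=> h; rewrite ltnS => /IH; apply: le_trans; exact: ltW.
Qed.

Lemma measurable_norm_sub_borel y :
  measurable_fun setT (fun x : borel X => `|Phi x - y|).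
Proof.
apply: (continuous_measurable_borel (f := fun x : X => `|Phi x - y|)) => x.
by apply: cvg_norm; apply: cvgB; [exact: Phi_cont|exact: cvg_cst].
Qed.

(** At stage m + 1 the index changes exactly on the set where one measurable
    function is below another, the right one being measurable because the index of
    stage m takes finitely many values. *)
Lemma measurable_nearest m (Q : set nat) : measurable (nearest m @^-1` Q : set (borel X)).
Proof.
elim: m Q => [|m IH] Q.
  rewrite (_ : _ @^-1` Q = if 0%N \in Q then setT else set0).
    by case: ifP.
  by case: ifPn; rewrite ?inE ?notin_setE => Q0; apply/seteqP; split.
pose A : set (borel X) :=
  [set x | `|Phi x - Phi (u m.+1)| < `|Phi x - Phi (u (nearest m x))|].
have mA : measurable A.
  have mJ (i : 'I_m.+1) : measurable ((nearest_ord m : borel X -> 'I_m.+1) @^-1` [set i]).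
    by rewrite preimage_nearest_ord; exact: IH.
  have m1 := measurable_norm_sub_cells (fun i : 'I_m.+1 => Phi (u i)) mJ measurable_norm_sub_borel.
  have := measurable_fun_ltr (measurable_norm_sub_borel (Phi (u m.+1))) m1.
  move=> /(_ measurableT [set true] I); rewrite setTI.
  congr (measurable _); apply/seteqP; split => x /=; rewrite nearest_ordE.
    by [].
  by [].
rewrite (_ : _ @^-1` Q = (A `&` (if m.+1 \in Q then setT else set0)) `|`
    (~` A `&` nearest m @^-1` Q)).
  apply: measurableU; apply: measurableI => //.
    by case: ifP.
  exact: measurableC.
have sE (b : bool) (x : X) : (if b then [set: borel X] else set0) x <-> b by case: b.
apply/seteqP; split => x; rewrite /A /=.
  case: ifPn => h Qx; first by left; split => //; apply/sE; rewrite inE.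
  by right; split => //; exact/negP.
move=> [[h /sE]|[/negP h Qx]]; last by rewrite (negPf h).
by rewrite h inE.
Qed.

Lemma measurable_nearest_ord m (i : 'I_m.+1) :
  measurable ((nearest_ord m : borel X -> 'I_m.+1) @^-1` [set i]).
Proof. by rewrite preimage_nearest_ord; exact: measurable_nearest. Qed.

Lemma quantizeE m x : quantize m x = Phi (u (nearest_ord m x)).
Proof. by rewrite nearest_ordE. Qed.

Hypothesis u_dense : forall x (e : R), 0 < e -> exists j, `|Phi x - Phi (u j)| < e.

Lemma cvg_quantize x : quantize m x @[m --> \oo] --> Phi x.
Proof.
apply/cvgrPdist_lt => e e0; have [j hj] := u_dense x e0.
near=> m; apply: le_lt_trans hj; apply: quantize_min.
by near: m; exact: nbhs_infty_ge.
Unshelve. all: by end_near. Qed.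

Context (B : R) (P : probability (borel X) R).
Hypothesis Phi_bounded : forall x, `|Phi x| <= B.

Lemma cvg_integral_quantize :
  (\int[P]_x (`|Phi x - quantize m x|)%:E)%E @[m --> \oo] --> 0%E.
Proof.
have mq m : measurable_fun setT (fun x : borel X => (`|Phi x - quantize m x|)%:E).
  apply/measurable_EFinP; under eq_fun do rewrite quantizeE.
  apply: (measurable_norm_sub_cells (fun i : 'I_m.+1 => Phi (u i))) => [i|].
    exact: measurable_nearest_ord.
  exact: measurable_norm_sub_borel.
have cq : {ae P, forall x : borel X, setT x ->
    (`|Phi x - quantize m x|)%:E @[m --> \oo] --> (cst 0%E : borel X -> \bar R) x}.
  apply: aeW => x _; apply: cvg_EFin; first by near=> m.
  rewrite -[X in _ --> X](normr0 E) -[X in `|X|](subrr (Phi x)).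
  by apply: cvg_norm; apply: cvgB; [exact: cvg_cst|exact: cvg_quantize].
have bq : {ae P, forall x : borel X, forall m, setT x ->
    (`|(`|Phi x - quantize m x|)%:E| <= (EFin \o cst (2 * B)%R) x)%E}.
  apply: aeW => x m _; rewrite /= normr_id lee_fin.
  apply: le_trans (ler_normB _ _) _.
  by rewrite mulrDl mul1r lerD ?Phi_bounded.
have [_ _] := dominated_convergence measurableT mq (measurable_cst _) cq
  (finite_measure_integrable_cst _ _ measurableT) bq.
by rewrite integral0.
Unshelve. all: by end_near. Qed.

(** The quantized maps are simple, converge pointwise and in L^1 to Phi, and their
    integrals form a Cauchy sequence; so they witness the Bochner integrability of
    Phi, whose integral is the limit by uniqueness. *)
Lemma quantize_mean_cvg :
  (\sum_i cell_prob P (nearest_ord m : borel X -> 'I_m.+1) i *: Phi (u i)) @[m --> \oo] -->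
  bochner_integral P (Phi : borel X -> E).
Proof.
have fq m : (quantize m : borel X -> E) \in fimfun.
  rewrite inE; apply: (sub_finite_set (B := [set` [seq Phi (u i) | i : 'I_m.+1]])).
    move=> _ [x _ <-]; rewrite /= quantizeE.
      by apply/mapP; exists (nearest_ord m x); rewrite ?mem_enum.
  exact: finite_seq.
pose s m : {fimfun borel X >-> E} := fimfun_Sub (fq m).
have sE m x : s m x = quantize m x by rewrite /s fimfun_valP.
have IE m : bochner_sintegral P (s m) =
    \sum_i cell_prob P (nearest_ord m : borel X -> 'I_m.+1) i *: Phi (u i).
  apply: (bochner_sintegral_cells P (@measurable_nearest_ord m)
    (Y := fun i : 'I_m.+1 => Phi (u i))) => x.
  by rewrite sE quantizeE.
have ms m : bochner_simple (s m).
  move=> y; have -> : s m = quantize m :> (borel X -> E) by apply/funext.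
  exact: (measurable_nearest m [set j | Phi (u j) = y]).
under eq_cvg do rewrite -IE.
have i0 : (\int[P]_x (`|Phi x - s m x|)%:E)%E @[m --> \oo] --> 0%E.
  have sI m : (\int[P]_x (`|Phi x - s m x|)%:E = \int[P]_x (`|Phi x - quantize m x|)%:E)%E.
    by apply: eq_integral => x _; rewrite sE.
  by under eq_cvg do rewrite sI; exact: cvg_integral_quantize.
have cI : cvg (bochner_sintegral P (s m) @[m --> \oo]).
  apply/cauchy_cvgP; apply: cauchy_exP => e e0.
  have /fine_cvgP[finI /cvgrPdist_lt /(_ (e / 2))] := i0.
  have e20 : 0 < e / 2 by rewrite divr_gt0.
  move=> /(_ e20) hI.
  have := filterI finI hI; case=> N _ hN.
  exists (bochner_sintegral P (s N)); exists N => // n /= Nn.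
  rewrite -ball_normE /ball_ /= -lte_fin.
  apply: le_lt_trans (bochner_sintegral_dist P measurable_norm_sub_borel (ms N) (ms n)) _.
  have h k : (N <= k)%N -> (\int[P]_x (`|Phi x - s k x|)%:E < (e / 2)%:E)%E.
    move=> /hN[fk]; rewrite /= sub0r normrN => hk.
    by rewrite -(fineK fk) lte_fin; apply: le_lt_trans hk; exact: ler_norm.
  by rewrite [e in X in (_ < X)%E]splitr EFinD; apply: lteD; apply: h.
have hb : has_bochner_integral P (Phi : borel X -> E) (lim (bochner_sintegral P (s m) @[m --> \oo])).
  exists s; split => //.
  by apply: aeW => x; under eq_cvg do rewrite sE; exact: cvg_quantize.
rewrite /bochner_integral (xget_unique 0 hb)// => v hv.
exact: (has_bochner_integral_unique measurable_norm_sub_borel hv hb).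
Qed.

End nearest_point.
(** * Quantized samples and passage to the limit *)

Section iid_cells.
Context (R : realType) (d d' : measure_display) (Omega : measurableType d).
Context (T : measurableType d') (Pr : probability Omega R) (P : probability T R).
Context (n : nat) (Z : 'I_n -> {RV Pr >-> T}) (I : finType) (J : T -> I).
Hypothesis Z_iid : iid P Z.
Hypothesis mJ : forall i, measurable (J @^-1` [set i]).

Definition sample_cells (w : Omega) : {ffun 'I_n -> I} := [ffun t => J (Z t w)].

Lemma preimage_sample_cells (a : {ffun 'I_n -> I}) : sample_cells @^-1` [set a] =
  \bigcap_(t in [set` [set: 'I_n]%SET]) (Z t @^-1` (J @^-1` [set a t])).
Proof.
apply/seteqP; split => w /=.
  by move=> <- t _ /=; rewrite ffunE.
by move=> h; apply/ffunP => t; rewrite ffunE; apply: h; rewrite /= inE.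
Qed.

Lemma measurable_sample_cells a : measurable (sample_cells @^-1` [set a]).
Proof.
rewrite preimage_sample_cells; apply: fin_bigcap_measurable => // t _.
by rewrite -[X in measurable X]setTI; apply: measurable_funPT.
Qed.

Lemma cell_prob_sample a : cell_prob Pr sample_cells a = \prod_t cell_prob P J (a t).
Proof.
have [Zd Zi] := Z_iid.
rewrite /cell_prob preimage_sample_cells (Zi _ (fun t => J @^-1` [set a t]))//.
have ZE t : Pr (Z t @^-1` (J @^-1` [set a t])) = (cell_prob P J (a t))%:E.
  by rewrite -cell_probE// -(Zd t).
rewrite (eq_bigr (fun t => (cell_prob P J (a t))%:E)); last by move=> t _; exact: ZE.
rewrite prodEFin /=.
by apply: eq_bigl => t; rewrite inE.
Qed.

Lemma prob_sample_cells (Q : pred {ffun 'I_n -> I}) :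
  Pr [set w | Q (sample_cells w)] = (iid_prob (cell_prob P J) Q)%:E.
Proof.
rewrite (measure_preimage_cells Pr measurable_sample_cells) /iid_prob /iid_expect.
congr EFin; rewrite big_mkcond; apply: eq_bigr => a _.
by rewrite cell_prob_sample; case: (Q a); rewrite ?mulr1 ?mulr0.
Qed.

End iid_cells.

(** If f0 w < g0 w then f m w < g m w for all large m, so the limit event lies in the
    increasing union over N of the intersections over m >= N, each of which has
    probability at most c. *)
Lemma prob_lt_limit (d : measure_display) (T : measurableType d) (R : realType)
    (Pr : probability T R) (f g : nat -> T -> R) (f0 g0 : T -> R) (c : \bar R) :
  (forall m, measurable_fun setT (f m)) -> (forall m, measurable_fun setT (g m)) ->
  (forall w, f m w @[m --> \oo] --> f0 w) -> (forall w, g m w @[m --> \oo] --> g0 w) ->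
  (forall m, (Pr [set w | (f m w < g m w)%R] <= c)%E) ->
  measurable [set w | f0 w < g0 w] /\ (Pr [set w | (f0 w < g0 w)%R] <= c)%E.
Proof.
move=> mf mg ff gg fgc.
have mlt (f' g' : T -> R) : measurable_fun setT f' -> measurable_fun setT g' ->
    measurable [set w | f' w < g' w].
  move=> mf' mg'; have := measurable_fun_ltr mf' mg' => /(_ measurableT [set true] I).
  by rewrite setTI.
have mf0 : measurable_fun setT f0 by apply: (measurable_fun_cvg mf) => w _; exact: ff.
have mg0 : measurable_fun setT g0 by apply: (measurable_fun_cvg mg) => w _; exact: gg.
split; first exact: mlt.
pose F N := \bigcap_(m in [set m | (N <= m)%N]) [set w | f m w < g m w].
have mF N : measurable (F N) by apply: bigcap_measurable => [|m _]; [exists N => /=|exact: mlt].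
have mUF : measurable (\bigcup_N F N) by exact: bigcup_measurable.
apply: (@le_trans _ _ (Pr (\bigcup_N F N))).
  apply: le_measure; rewrite ?inE//; first exact: mlt.
  move=> w /= fgw.
  have := gg w => /cvgrPdist_lt /(_ ((g0 w - f0 w) / 2)).
  have := ff w => /cvgrPdist_lt /(_ ((g0 w - f0 w) / 2)).
  have e0 : 0 < (g0 w - f0 w) / 2 by rewrite divr_gt0 ?subr_gt0.
  move=> /(_ e0) h1 /(_ e0) h2; have := filterI h1 h2; case=> N _ hN.
  exists N => // m /= Nm; have [] := hN m Nm.
  by rewrite /= !ltr_norml => /andP[? ?] /andP[? ?]; lra.
have hF : {homo F : N M / (N <= M)%N >-> (N <= M)%O}.
  move=> N M NM; apply/subsetPset => w FN m /= Mm; apply: FN => /=.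
  exact: leq_trans Mm.
have cF : Pr (F N) @[N --> \oo] --> Pr (\bigcup_N F N) by exact: nondecreasing_cvg_mu.
apply: (cvge_to_le cF).
near=> N; apply: le_trans (fgc N); apply: le_measure; rewrite ?inE//; first exact: mlt.
by move=> w; apply => /=.
Unshelve. all: by end_near. Qed.
(** * The canonical feature map of the kernel *)

Lemma cvg_sumr (R : realType) (V : normedModType R) (T : Type) (F : set_system T)
    (FF : Filter F) (I : finType) (f : I -> T -> V) (a : I -> V) :
  (forall i, f i x @[x --> F] --> a i) -> \sum_i f i x @[x --> F] --> \sum_i a i.
Proof. by move=> fa; apply: cvg_big => // x; exact: add_continuous. Qed.

Lemma cvg_sqrtr (R : realType) (T : Type) (F : set_system T) (FF : Filter F)
    (f : T -> R) (a : R) :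
  f @ F --> a -> Num.sqrt (f x) @[x --> F] --> Num.sqrt a.
Proof. by move=> fa; apply: (cvg_comp _ _ fa); exact: sqrt_continuous. Qed.

Lemma le_oscillation (R : realType) (T : Type) (f : T -> R) :
  has_ubound (range f) -> has_lbound (range f) ->
  forall p q, f p - f q <= oscillation f.
Proof.
move=> fu fl p q; apply: lerB; first by apply: ub_le_sup => //; exists p.
by apply: ge_inf => //; exists q.
Qed.

Section rkhs_feature_map.
Context (R : realType) (X : ptopologicalType) (k : X -> X -> R) (H : rkhs k).
Hypothesis k_continuous : continuous (fun p : X * X => k p.1 p.2).
Hypothesis k_bounded : has_ubound (range (fun x : X => k x x)).

Lemma dot_rkhs_at x y : rkhs_dot H (rkhs_at H x) (rkhs_at H y) = k x y.
Proof. by rewrite -rkhs_reproducing rkhs_atE. Qed.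

Lemma sqr_norm_rkhs_at x : `|rkhs_at H x| ^+ 2 = k x x.
Proof. by rewrite rkhs_normE dot_rkhs_at. Qed.

(** |Phi y - Phi x|^2 = k(y,y) + k(x,x) - 2 k(y,x) tends to 0 as y tends to x. *)
Lemma rkhs_at_continuous : continuous (rkhs_at H : X -> H).
Proof.
move=> x; apply/subr_cvg0/norm_cvg0P.
have nE y : `|rkhs_at H y - rkhs_at H x| = Num.sqrt (k y y + k x x - 2 * k y x).
  by rewrite -!sqr_norm_rkhs_at -dot_rkhs_at -(sqr_normB (@rkhs_normE _ _ _ H)) sqrtr_sqr normr_id.
under eq_cvg do rewrite nE.
suff : Num.sqrt (k y y + k x x - 2 * k y x) @[y --> x] -->
    Num.sqrt (k x x + k x x - 2 * k x x).
  by rewrite (_ : _ - _ = 0) ?sqrtr0//; ring.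
apply: cvg_sqrtr.
have kc (f g : X -> X) : f @ x --> f x -> g @ x --> g x ->
    k (f y) (g y) @[y --> x] --> k (f x) (g x).
  move=> fx gx.
  exact: (cvg_comp _ _ (cvg_pair fx gx) (@k_continuous (f x, g x))).
apply: cvgB; [apply: cvgD|apply: cvgM]; [|exact: cvg_cst|exact: cvg_cst|].
- by apply: (kc id id); exact: cvg_id.
- by apply: (kc id (cst x)); [exact: cvg_id|exact: cvg_cst].
Qed.

Lemma rkhs_at_bounded : exists B, forall x, `|rkhs_at H x| <= B.
Proof.
have [b kb] := k_bounded; exists (Num.sqrt b) => x.
rewrite -[leLHS]normr_id -sqrtr_sqr ler_wsqrtr// sqr_norm_rkhs_at.
by apply: kb; exists x.
Qed.

(** By the Cauchy-Schwarz inequality the boundedness of the diagonal bounds the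
    whole kernel, so that its supremum and infimum are genuine bounds. *)
Lemma kernel_osc p q : k p.1 p.2 - k q.1 q.2 <= oscillation (fun p : X * X => k p.1 p.2).
Proof.
have [B hB] := rkhs_at_bounded.
have kB (r : X * X) : `|k r.1 r.2| <= B ^+ 2.
  rewrite -dot_rkhs_at; apply: le_trans (norm_dot_le (@rkhs_normE _ _ _ H) _ _) _.
  by rewrite expr2 ler_pM.
apply: (le_oscillation (f := fun p : X * X => k p.1 p.2)).
- by exists (B ^+ 2) => _ [r _ <-]; apply: le_trans (kB r); exact: ler_norm.
- by exists (- B ^+ 2) => _ [r _ <-]; have := kB r; rewrite ler_norml => /andP[].
Qed.

Lemma diag_osc_ge0 : 0 <= oscillation (fun x : X => k x x).
Proof.
rewrite -(subrr (k point point)); apply: (le_oscillation (f := fun x => k x x)) => //.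
by exists 0 => _ [x _ <-]; rewrite -sqr_norm_rkhs_at sqr_ge0.
Qed.

End rkhs_feature_map.

Theorem theoremA1 (R : realType) (X : ptopologicalType) (k : X -> X -> R)
    (H : rkhs k) (P : probability (borel X) R)
    (d : measure_display) (Omega : measurableType d) (Pr : probability Omega R)
    (n : nat) (Z : 'I_n -> {RV Pr >-> borel X}) (delta : R)
    (X_separable : separable X)
    (k_continuous : continuous (fun p : X * X => k p.1 p.2))
    (k_bounded : has_ubound (range (fun x : X => k x x)))
    (k_pd : positive_definite k)
    (k_characteristic : characteristic H)
    (n_ge2 : (2 <= n)%N)
    (Z_iid : iid P Z)
    (delta_gt0 : 0 < delta) (delta_lt1 : delta < 1) :
  let Dk := oscillation (fun p : X * X => k p.1 p.2) in
  let Ddiag := oscillation (fun x : X => k x x) in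
  with_probability_at_least Pr (1 - delta)
    [set w : Omega |
      `|empirical_embedding H (fun t => Z t w) - mean_embedding H P| <=
        Num.sqrt (2 * (vhat k (fun t => Z t w) + Ddiag) * (ln (4 / delta) / n%:R))
        + (16 / 3 * Num.sqrt Dk + 2 * Num.sqrt 2 * Num.sqrt Ddiag)
          * (ln (4 / delta) / n%:R)].
Proof.
move=> Dk Ddiag; set L := ln (4 / delta) / n%:R.
have nR0 : 0 < n%:R :> R by rewrite ltr0n; apply: leq_trans n_ge2.
have d41 : 1 < 4 / delta by rewrite ltr_pdivlMr//; lra.
have L0 : 0 < L by rewrite divr_gt0// ln_gt0.
have nL : 3 * expR (- (n%:R * L)) <= delta.
  rewrite /L mulrCA divff ?lt0r_neq0// mulr1 expRN lnK ?posrE; last exact: lt_trans d41.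
  by rewrite invf_div; lra.
have Dd0 : 0 <= Ddiag by exact: (diag_osc_ge0 H).
pose c2 := 16 / 3 * Num.sqrt Dk + 2 * Num.sqrt 2 * Num.sqrt Ddiag.
have Phic : continuous (rkhs_at H : X -> H) := rkhs_at_continuous k_continuous.
have [B PhiB] := rkhs_at_bounded H k_bounded.
have [u u_dense] := separable_dense_seq X_separable Phic.
(* Stage m of the quantization: J m x is the cell of x, p m the law of the cell,
   mu m its mean in H and q m w the quantized sample. *)
pose J m : borel X -> 'I_m.+1 := nearest_ord (rkhs_at H) u m.
pose p m := cell_prob P (J m).
pose mu m : H := \sum_i p m i *: rkhs_at H (u i).
pose q m w (t : 'I_n) := u (J m (Z t w)).
pose rhs (x : 'I_n -> X) := Num.sqrt (2 * (vhat k x + Ddiag) * L) + c2 * L.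
have mJ m i : measurable (J m @^-1` [set i]) by exact: measurable_nearest_ord.
have cvgq t w : rkhs_at H (q m w t) @[m --> \oo] --> rkhs_at H (Z t w).
  by under eq_cvg do rewrite -quantizeE; exact: cvg_quantize.
have cvgk s t w : k (q m w s) (q m w t) @[m --> \oo] --> k (Z s w) (Z t w).
  rewrite -(dot_rkhs_at H); under eq_cvg do rewrite -(dot_rkhs_at H).
  by apply: (cvg_dot (@rkhs_normE _ _ _ H)); exact: cvgq.
pose dev m (x : 'I_n -> X) := `|empirical_embedding H x - mu m|.
have mfun m (F : ('I_n -> X) -> R) : measurable_fun setT (fun w => F (q m w)).
  rewrite (_ : (fun w => _) =
      (fun a : {ffun 'I_n -> 'I_m.+1} => F (fun t => u (a t))) \o sample_cells Z (J m)); last first.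
    by apply/funext => w /=; congr F; apply/funext => t; rewrite ffunE.
  by apply: (measurable_cells_fun (measurable_sample_cells Z (mJ m))).
have cvg_rhs w : rhs (q m w) @[m --> \oo] --> rhs (fun t => Z t w).
  apply: cvgD; last exact: cvg_cst.
  apply: cvg_sqrtr.
  apply: cvgM; last exact: cvg_cst.
  apply: cvgM; first exact: cvg_cst.
  apply: cvgD; last exact: cvg_cst.
  apply: cvgM; first exact: cvg_cst.
  apply: cvg_sumr => t; apply: cvgB => //.
  by apply: cvgM; [exact: cvg_cst|apply: cvg_sumr].
have cvg_lhs w : dev m (q m w) @[m --> \oo] -->
    `|empirical_embedding H (fun t => Z t w) - mean_embedding H P|.
  apply: cvg_norm; apply: cvgB; last exact: quantize_mean_cvg.
  by apply: cvgZr; apply: cvg_sumr.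
have bad_le m : (Pr [set w | (rhs (q m w) < dev m (q m w))%R] <= delta%:E)%E.
  pose Q (a : {ffun 'I_n -> 'I_m.+1}) := rhs (fun t => u (a t)) < dev m (fun t => u (a t)).
  rewrite (_ : [set w | _] = [set w | Q (sample_cells Z (J m) w)]); last first.
    have qE w : q m w = (fun t => u (sample_cells Z (J m) w t)).
      by apply/funext => t; rewrite ffunE.
    by apply/seteqP; split => w; rewrite /= qE.
  rewrite (prob_sample_cells Z_iid (mJ m)) lee_fin; apply: le_trans nL.
  have p0 i : 0 <= p m i by exact: cell_prob_ge0.
  have p1 : \sum_i p m i = 1 by exact: (sum_cell_prob P (mJ m)).
  have osc i j l l' : rkhs_dot H (rkhs_at H (u (i : 'I_m.+1))) (rkhs_at H (u (j : 'I_m.+1))) -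
      rkhs_dot H (rkhs_at H (u (l : 'I_m.+1))) (rkhs_at H (u (l' : 'I_m.+1))) <= Dk.
    by rewrite !dot_rkhs_at; exact: (kernel_osc H k_bounded (u i, u j) (u l, u l')).
  have := finite_empirical_bernstein (@rkhs_normE _ _ _ H) p0 p1 osc n_ge2 L0.
  apply: le_trans; apply: iid_prob_le => // a; apply: le_lt_trans.
  (* Both terms in Ddiag are nonnegative. *)
  rewrite (_ : vhat _ a = vhat k (fun t => u (a t))); last first.
    rewrite /vhat; congr (_ * _); apply: eq_bigr => t _; rewrite dot_rkhs_at.
    by congr (_ - _ * _); apply: eq_bigr => s _; rewrite dot_rkhs_at.
  rewrite /rhs lerD//.
    by rewrite ler_wsqrtr// ler_wpM2r ?(ltW L0)// ler_wpM2l// lerDl.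
  by rewrite ler_wpM2r ?(ltW L0)// /c2 lerDl !mulr_ge0 ?sqrtr_ge0.
have [mbad bad] := prob_lt_limit (fun m => mfun m rhs) (fun m => mfun m (dev m))
  cvg_rhs cvg_lhs bad_le.
rewrite (_ : [set w | _] = ~` [set w | rhs (fun t => Z t w) <
    `|empirical_embedding H (fun t => Z t w) - mean_embedding H P|]); last first.
  by apply/seteqP; split => w /=; rewrite leNgt => /negP.
split; first exact: measurableC.
by rewrite probability_setC// EFinB leeB.
Qed.
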